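(* Let $k$ be an algebraically closed field of characteristic $0$. For $n\ge 1$ let $V_n=k[x,y]_n$ be the space of binary forms of degree $n$, with its action of $SL_2(k)$, and let $T\subset SL_2(k)$ be the maximal torus of diagonal matrices. Then, as $n\to\infty$, the cardinality of a minimal generating set for the $k$-algebra $k[V_n]^T$ is at most (a) $O\left(n e^{6\sqrt{n}\log 2n}\right)$ for odd $n$; (b) $O\left(n e^{12\sqrt{n/2}\log n}\right)$ for even $n$.
   Context: The action of $SL_2(k)$ on $V_n$ is $\begin{pmatrix}\alpha&\beta\\ \gamma&\delta\end{pmatrix}\cdot f(x,y)=f(\alpha x+\gamma y,\beta x+\delta y)$. $k[V_n]$ is the ring of polynomial functions on $V_n$; writing a binary form as $a_nx^n+\cdots+a_0y^n$, the coordinate ring is a polynomial ring in $n+1$ variables which, after re-indexing by weight, are $a_n,a_{n-2},\ldots,a_{-(n-2)},a_{-n}$ with $a_i$ of weight $i$ under $T\cong k^*$. $k[V_n]^T$ is the subring of $T$-invariant functions. A minimal generating set is a generating set (as $k$-algebra) of minimal cardinality. $\log$ is the natural logarithm. *)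

(* Defs.v *)
From HB Require Import structures.
From mathcomp Require Import all_boot all_order all_algebra.
From mathcomp Require Import mpoly.

Set Implicit Arguments.
Unset Strict Implicit.
Unset Printing Implicit Defensive.

Import GRing.Theory.
Local Open Scope ring_scope.

(* Binary forms of degree n are the f : {mpoly k[2]} with f \is n.-homog,
   where 'X_0 is x and 'X_1 is y. *)

(* g = (alpha, beta; gamma, delta) acts by
   (g . f)(x, y) = f (alpha x + gamma y, beta x + delta y). *)
Definition form_act (k : fieldType) (g : 'M[k]_2) (f : {mpoly k[2]}) :
    {mpoly k[2]} :=
  f \mPo [tuple \sum_(i < 2) g i j *: 'X_i | j < 2].

Definition in_SL2 (k : fieldType) (g : 'M[k]_2) : bool := \det g == 1.

Definition in_torus (k : fieldType) (t : 'M[k]_2) : bool :=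
  in_SL2 t && is_diag_mx t.

(* The coefficient of x^i y^(n - i). *)
Definition form_coord (k : fieldType) (n : nat) (f : {mpoly k[2]})
    (i : 'I_n.+1) : k :=
  f@_(U_(0%R) *+ i + U_(1%R) *+ (n - i))%MM.

(* k[V_n] is {mpoly k[n.+1]}: over an infinite field, polynomials in the
   coordinates of V_n and polynomial functions on V_n are the same thing. The
   variable 'X_i is the coordinate of x^i y^(n - i), of weight 2i - n under
   diag(alpha, alpha^-1). *)
Definition eval_form (k : fieldType) (n : nat) (P : {mpoly k[n.+1]})
    (f : {mpoly k[2]}) : k :=
  P.@[form_coord f].

Definition torus_invariant (k : fieldType) (n : nat) (P : {mpoly k[n.+1]}) :
    Prop :=
  forall (t : 'M[k]_2) (f : {mpoly k[2]}),
    in_torus t -> f \is n.-homog ->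
    eval_form P (form_act t f) = eval_form P f.

(* S lies in k[V_n]^T, and every element of k[V_n]^T is a polynomial expression
   in the elements of S. *)
Definition generates_invariants (k : fieldType) (n : nat)
    (S : seq {mpoly k[n.+1]}) : Prop :=
  (forall P, P \in S -> torus_invariant P) /\
  (forall P : {mpoly k[n.+1]}, torus_invariant P ->
     exists Q : {mpoly k[size S]}, P = Q \mPo in_tuple S).

(* Finite sets are duplicate-free sequences; m is the cardinality of a
   generating set of minimal cardinality. *)
Definition minimal_generating_card (k : fieldType) (n m : nat) : Prop :=
  (exists S : seq {mpoly k[n.+1]},
     [/\ uniq S, generates_invariants S & size S = m]) /\
  (forall S : seq {mpoly k[n.+1]},
     uniq S -> generates_invariants S -> (m <= size S)%N).

(* Main.v *)
Require Import Defs.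
From HB Require Import structures.
From mathcomp Require Import all_boot all_order all_algebra.
From mathcomp Require Import zify boolp.
From mathcomp Require mpoly.

(** Why the theorem is true.

    The torus scales every monomial of k[V_n], so k[V_n]^T is spanned by the
    monomials of weight zero and is generated by those among them that are not
    products of two others.  Such an indecomposable monomial is a multiset S
    of weights in [-n, n] with sum zero and no proper nonempty part of sum
    zero.  The number of these multisets bounds the cardinality of a minimal
    generating set, so everything reduces to counting them.

    The heart of the matter is that S has few distinct weights: if there are t
    of them, then t^2 <= 32 n + 48 + 4 t ([irreducible_support]).  Split S into
    two parts U and U', each of total in [-n, n].  A subset sum of U and the
    opposite of a subset sum of U' are equal only in two trivial cases, because
    S has no proper part of sum zero; so U and U' have together at most 2n + 3
    subset sums in the window [-n, n] ([window_sums_half]).  On the other hand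
    the subset sums of U are many.  Remove the elements of U one by one, always
    choosing the sign that keeps the running total in the window.  When f is
    removed, the subset sums that use f form a translate of those of what is
    left, and each remaining e of the same sign contributes one more value,
    unless e - f is itself a subset sum of the rest ([window_sums_gain],
    [zigzag_ind]).  This exception cannot be frequent: if e - f is a subset sum
    of one part of S and f - e is a subset sum of a disjoint part, then both
    parts together have sum zero.  Averaging over the ways to split S, at least
    half of the pairs (f, e) contribute ([unlinked_exchange]), which is a
    number of values quadratic in t.  To keep the totals of U and U' in the
    window, S is sorted, consecutive elements are paired, and each pair is split
    between U and U': the differences within the pairs are disjoint gaps of an
    interval of length 2n.

    The same removal process applied to S without one element, with the
    value 0 in place of the values e, shows that S has at most 2n + 2 elements
    ([irreducible_degree]).

    It remains to count the multisets with at most 6 sqrt n distinct weights and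
    2n + 2 elements.  Give the multiset m the weight y^(distinct) z^(size) with
    y = 1 / (n + 1) and z = exp (- 1 / sqrt n).  The sum of all the weights is a
    product over the n + 1 coordinates and is at most exp (1 + sqrt n)
    ([sum_weight_mults]), and each of the multisets to be counted has weight at
    least exp (- 6 sqrt n ln (n + 1) - (2n + 2) / sqrt n).  Hence their number is
    at most exp (6 sqrt n ln n + 3 sqrt n + 9) ([card_sparse_mults]).  For
    n >= 100 this is at most e^9 times the first bound, because ln 2 >= 1/2, and
    at most e^9 times the second one, because 12 sqrt (n / 2) > 8 sqrt n. *)

Set Implicit Arguments.
Unset Strict Implicit.
Unset Printing Implicit Defensive.

Import Order.TTheory GRing.Theory Num.Theory.
Local Open Scope ring_scope.

(** * Subset sums in a window *)

Lemma sum_setU_disjoint (I : finType) (F : I -> int) (A B : {set I}) :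
  [disjoint A & B] ->
  \sum_(i in A :|: B) F i = \sum_(i in A) F i + \sum_(i in B) F i.
Proof.
move=> dis; rewrite (big_setID A) /= setIUl setIid (setUidPl (subsetIr _ _)).
by rewrite setDUl setDv set0U (setDidPl _) // disjoint_sym.
Qed.

Section SubsetSums.
Variables (I : finType) (v : I -> int) (N : nat).
Hypothesis v_bound : forall i, - N%:Z <= v i <= N%:Z.

Definition is_subsum (X : {set I}) (b : int) : bool :=
  [exists A : {set I}, (A \subset X) && (\sum_(i in A) v i == b)].

Lemma is_subsumP (X : {set I}) (b : int) :
  reflect (exists2 A : {set I}, A \subset X & \sum_(i in A) v i = b)
          (is_subsum X b).
Proof.
apply: (iffP existsP) => [[A /andP[sAX /eqP]]|[A sAX /eqP eqb]]; first by exists A.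
by exists A; rewrite sAX.
Qed.

Lemma subsumS (X Y : {set I}) (b : int) :
  X \subset Y -> is_subsum X b -> is_subsum Y b.
Proof.
move=> sXY /is_subsumP[A sAX eqb]; apply/is_subsumP; exists A => //.
exact: subset_trans sXY.
Qed.

Lemma subsum1 (X : {set I}) (i : I) : i \in X -> is_subsum X (v i).
Proof.
by move=> iX; apply/is_subsumP; exists [set i]; rewrite ?sub1set ?big_set1.
Qed.

Lemma subsum0 (X : {set I}) : is_subsum X 0.
Proof. by apply/is_subsumP; exists set0; rewrite ?sub0set ?big_set0. Qed.

Lemma subsum_add (X : {set I}) (f : I) (b : int) : f \in X ->
  is_subsum (X :\ f) (b - v f) -> is_subsum X b.
Proof.
move=> fX /is_subsumP[A sA eqb]; apply/is_subsumP; exists (f |: A).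
  rewrite subUset sub1set fX; apply: (subset_trans sA); exact: subD1set.
rewrite big_setU1 /=; first by rewrite eqb addrC subrK.
by apply/negP => /(subsetP sA); rewrite !inE eqxx.
Qed.

(** The window [-N, N] is encoded as an ordinal type so that the subset sums in
    it can be counted. *)
Definition window_val (b : 'I_(N.*2.+1)) : int := b%:Z - N%:Z.

(** The parameter [W] is the total of the elements already removed: a subset
    sum [s] of what is left stands for the value [W + s]. *)
Definition window_sums (X : {set I}) (W : int) : {set 'I_(N.*2.+1)} :=
  [set b | is_subsum X (window_val b - W)].

Lemma window_onto (b : int) : - N%:Z <= b <= N%:Z -> exists c, window_val c = b.
Proof.
move=> bN; have lt_b : (absz (b + N%:Z)%R < N.*2.+1)%N by lia.
by exists (Ordinal lt_b); rewrite /window_val /=; lia.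
Qed.

Lemma window_inj : injective window_val.
Proof. by move=> b c; rewrite /window_val => bc; apply: val_inj => /=; lia. Qed.

(** The values obtained with [f] are those of [X :\ f] seen from the new total
    [W + v f].  A value [W + u e] is not one of them when [u e - v f] is not a
    subset sum of [X :\ f], so it comes in addition. *)
Lemma window_sums_gain (J : finType) (u : J -> int) (E : {set J})
    (f : I) (X : {set I}) (W : int) :
  f \in X -> {in E &, injective u} ->
  {in E, forall e, - N%:Z <= W + u e <= N%:Z} ->
  {in E, forall e, is_subsum X (u e)} ->
  {in E, forall e, ~~ is_subsum (X :\ f) (u e - v f)} ->
  (#|window_sums (X :\ f) (W + v f)| + #|E| <= #|window_sums X W|)%N.
Proof.
move=> fX uI uW uX uXf.
(* The position of W + u e; it exists, so the default value is never used. *)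
pose c e := odflt ord0 [pick b | window_val b == W + u e].
have cE e : e \in E -> window_val (c e) = W + u e.
  move=> eE; rewrite /c; case: pickP => [b /eqP //|no].
  by have [b bE] := window_onto (uW _ eE); have := no b; rewrite bE eqxx.
have cI : {in E &, injective c}.
  move=> e e' eE e'E /(congr1 window_val); rewrite !cE // => /addrI; exact: uI.
have sub : window_sums (X :\ f) (W + v f) :|: c @: E \subset window_sums X W.
  rewrite subUset; apply/andP; split.
    apply/subsetP => b; rewrite !inE opprD addrA; exact: subsum_add.
  by apply/subsetP => _ /imsetP[e eE ->]; rewrite inE cE // addrC addKr uX.
apply: leq_trans (subset_leq_card sub).
rewrite cardsU -(card_in_imset cI) leq_subRL; last first.
  by rewrite (leq_trans (subset_leq_card (subsetIr _ _))) ?leq_addl.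
rewrite addnC -[leqRHS]addn0 leq_add2l leqn0 cards_eq0 -subset0.
apply/subsetP => b /setIP[+ /imsetP[e eE bE]]; rewrite {b}bE inE cE //.
have -> : W + u e - (W + v f) = u e - v f by lia.
by rewrite (negbTE (uXf _ eE)).
Qed.

(** Elements of both signs can be removed so that the total, increased by any
    remaining element of the sign that is chosen, stays in the window: take a
    positive element when the total is at most 0 and a negative one otherwise.
    When one sign is used up, the remaining elements all have the other sign, so
    the total increased by one of them lies between the current and the final
    total. *)
Lemma zigzag_ind (Q : seq I -> seq I -> int -> Prop) :
  (forall W : int, Q [::] [::] W) ->
  (forall f p q (W : int), - N%:Z <= W <= N%:Z ->
     {in f :: p, forall e, - N%:Z <= W + v e <= N%:Z} ->
     Q p q (W + v f) -> Q (f :: p) q W) ->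
  (forall f p q (W : int), - N%:Z <= W <= N%:Z ->
     {in f :: q, forall e, - N%:Z <= W + v e <= N%:Z} ->
     Q p q (W + v f) -> Q p (f :: q) W) ->
  forall p q (W : int), all (fun i => 0 < v i) p -> all (fun i => v i < 0) q ->
    - N%:Z <= W <= N%:Z ->
    - N%:Z <= W + \sum_(i <- p) v i + \sum_(i <- q) v i <= N%:Z ->
    Q p q W.
Proof.
move=> Q0 Qp Qq p q; move sz: (size p + size q)%N => k.
have sum_pos s e : all (fun i => 0 < v i) s -> e \in s ->
    v e <= \sum_(i <- s) v i.
  elim: s => //= a s IHs /andP[a0 s0]; rewrite inE big_cons.
  have sum0 : 0 <= \sum_(j <- s) v j.
    by rewrite big_seq sumr_ge0 // => i /(allP s0) /ltW.
  case/orP=> [/eqP->|/(IHs s0) le_e]; first by rewrite lerDl.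
  by rewrite (le_trans le_e) // lerDr ltW.
have sum_neg s e : all (fun i => v i < 0) s -> e \in s ->
    \sum_(i <- s) v i <= v e.
  elim: s => //= a s IHs /andP[a0 s0]; rewrite inE big_cons.
  have sum0 : \sum_(j <- s) v j <= 0.
    by rewrite big_seq sumr_le0 // => i /(allP s0) /ltW.
  case/orP=> [/eqP->|/(IHs s0) le_e]; first by rewrite gerDl.
  by rewrite (le_trans _ le_e) // gerDr ltW.
elim: k p q sz => [|k IHk] [|f p] [|g q] //= sz W pp qq WN SN.
- have WE e : e \in g :: q -> - N%:Z <= W + v e <= N%:Z.
    move=> eq; have := sum_neg (g :: q) e qq eq; have := allP (qq : all _ (g :: q)) e eq => /=.
    by move: SN; rewrite big_nil; lia.
  apply: Qq => //; apply: IHk => //=; first by case: sz => <-.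
  + by case/andP: qq.
  + by rewrite WE // mem_head.
  + by move: SN; rewrite big_nil big_cons; lia.
- have WE e : e \in f :: p -> - N%:Z <= W + v e <= N%:Z.
    move=> ep; have := sum_pos (f :: p) e pp ep; have := allP (pp : all _ (f :: p)) e ep => /=.
    by move: SN; rewrite big_nil; lia.
  apply: Qp => //; apply: IHk => //=; first by case: sz => <-.
  + by case/andP: pp.
  + by rewrite WE // mem_head.
  + by move: SN; rewrite big_nil big_cons; lia.
have [W0|W0] := lerP W 0.
- have WE e : e \in f :: p -> - N%:Z <= W + v e <= N%:Z.
    by move=> ep; have := allP (pp : all _ (f :: p)) e ep => /=; have := v_bound e; lia.
  apply: Qp => //; apply: IHk => //=; first by case: sz => <-.
  + by case/andP: pp.
  + by rewrite WE // mem_head.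
  + by move: SN; rewrite !big_cons; lia.
- have WE e : e \in g :: q -> - N%:Z <= W + v e <= N%:Z.
    by move=> eq; have := allP (qq : all _ (g :: q)) e eq => /=; have := v_bound e; lia.
  apply: Qq => //; apply: IHk => //=; first by case: sz => <-; rewrite addSnnS.
  + by case/andP: qq.
  + by rewrite WE // mem_head.
  + by move: SN; rewrite !big_cons; lia.
Qed.

(** The list is read as an order of removal. *)
Fixpoint ordered_pairs (r : rel I) (s : seq I) : nat :=
  if s is f :: s' then (count (r f) s' + ordered_pairs r s')%N else 0%N.

(** Every pair of distinct elements is in the right order in exactly one of a
    list and its reverse. *)
Lemma ordered_pairs_rev (r : rel I) (s : seq I) : irreflexive r ->
  (ordered_pairs r s + ordered_pairs r (rev s) =
   \sum_(f <- s) \sum_(e <- s) r f e)%N.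
Proof.
move=> r_irr.
have rcons_pairs t f :
    ordered_pairs r (rcons t f) = (ordered_pairs r t + count (r^~ f) t)%N.
  elim: t => //= a t ->; rewrite -cats1 count_cat /= addn0.
  by rewrite -!addnA; congr addn; rewrite addnCA.
elim: s => [|f s IHs] /=; first by rewrite big_nil.
have countE (a : pred I) t : count a t = (\sum_(i <- t) a i)%N.
  by elim: t => [|i t /= ->]; rewrite ?big_nil ?big_cons.
rewrite rev_cons rcons_pairs count_rev !big_cons r_irr add0n.
rewrite [X in _ = (_ + X)%N](eq_bigr (fun i => (r i f + \sum_(e <- s) r i e)%N)).
  by rewrite big_split /= -IHs -!countE; lia.
by move=> i _; rewrite big_cons.
Qed.

(** Each step of the zigzag gains one value for each [e] that is related to the
    removed [f] and follows it; the relation is stated with the subset sums of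
    the larger set [X0] so that it does not change during the process. *)
Lemma ordered_pairs_le (r : rel I) (X0 : {set I}) :
  (forall f, {in r f &, injective v}) ->
  (forall f e, r f e -> ~~ is_subsum (X0 :\ f) (v e - v f)) ->
  forall p q (W : int), all (fun i => 0 < v i) p -> all (fun i => v i < 0) q ->
    - N%:Z <= W <= N%:Z ->
    - N%:Z <= W + \sum_(i <- p) v i + \sum_(i <- q) v i <= N%:Z ->
    uniq (p ++ q) -> {subset p ++ q <= X0} ->
    (ordered_pairs r p + ordered_pairs r q
       <= #|window_sums [set i in p ++ q] W|)%N.
Proof.
move=> rI rX0 p q W pp qq WN SN.
pose Q p q W := uniq (p ++ q) -> {subset p ++ q <= X0} ->
    (ordered_pairs r p + ordered_pairs r q
       <= #|window_sums [set i in p ++ q] W|)%N.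
have rem (f : I) t : f \notin t -> [set i in f :: t] :\ f = [set i in t].
  move=> ft; apply/setP => i; rewrite !inE; case: eqP => //= ->.
  exact/esym/negbTE.
have step f t u (W' : int) : uniq (f :: u) -> {subset f :: u <= X0} ->
    uniq t -> {subset t <= u} ->
    {in f :: t, forall e, - N%:Z <= W' + v e <= N%:Z} ->
    (#|window_sums [set i in u] (W' + v f)| + count (r f) t
       <= #|window_sums [set i in f :: u] W'|)%N.
  move=> /= /andP[fu uu] sX0 ut tu tW.
  have -> : count (r f) t = #|[set e in t | r f e]|.
    rewrite -size_filter -(card_uniqP (filter_uniq _ ut)); apply: eq_card => e.
    by rewrite mem_filter !inE andbC.
  rewrite -(rem f u fu); apply: window_sums_gain.
  - by rewrite inE mem_head.
  - move=> e e'; rewrite !inE => /andP[_ re] /andP[_ re']; exact: rI re re'.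
  - by move=> e; rewrite !inE => /andP[et _]; rewrite tW // inE et orbT.
  - move=> e; rewrite !inE => /andP[et _]; apply: subsum1.
    by rewrite !inE (tu _ et) orbT.
  - move=> e; rewrite !inE => /andP[et /rX0]; apply: contra; apply: subsumS.
    by apply/setSD/subsetP => i; rewrite inE; apply: sX0.
apply: (zigzag_ind (Q := Q)) pp qq WN SN => {p q W} //= f p q W WN fW IH.
  rewrite /Q /= => u sX0.
  have sX0' : {subset p ++ q <= X0} by move=> i ipq; rewrite sX0 // inE ipq orbT.
  have := IH (proj2 (andP u)) sX0'; move=> {}IH.
  apply: leq_trans (step f p (p ++ q) W u sX0 _ _ _).
  - by rewrite -addnA addnC leq_add2r.
  - by case/andP: u; rewrite cat_uniq => _ /andP[].
  - by move=> i ip; rewrite mem_cat ip.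
  - exact: fW.
rewrite /Q /= => u sX0.
have perm : perm_eq (p ++ f :: q) (f :: (p ++ q)) by rewrite perm_catC /= perm_cons perm_catC.
have u' : uniq (f :: (p ++ q)) by rewrite -(perm_uniq perm).
have sX0' : {subset f :: (p ++ q) <= X0}.
  by move=> i; rewrite -(perm_mem perm); apply: sX0.
have -> : [set i in p ++ f :: q] = [set i in f :: (p ++ q)].
  by apply/setP => i; rewrite !inE (perm_mem perm).
have sX0'' : {subset p ++ q <= X0} by move=> i ipq; rewrite sX0' // inE ipq orbT.
have := IH (proj2 (andP u')) sX0''; move=> {}IH.
apply: leq_trans (step f q (p ++ q) W u' sX0' _ _ _).
- by rewrite addnCA [leqRHS]addnC leq_add2l.
- by move: u' => /= /andP[_]; rewrite cat_uniq => /and3P[].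
- by move=> i iq; rewrite mem_cat iq orbT.
- exact: fW.
Qed.


Definition positives (X : {set I}) := enum [set i in X | 0 < v i].
Definition negatives (X : {set I}) := enum [set i in X | v i < 0].

Lemma positives_gt0 (X : {set I}) : all (fun i => 0 < v i) (positives X).
Proof. by apply/allP => i; rewrite mem_enum inE => /andP[]. Qed.

Lemma negatives_lt0 (X : {set I}) : all (fun i => v i < 0) (negatives X).
Proof. by apply/allP => i; rewrite mem_enum inE => /andP[]. Qed.

Lemma signs_uniq (X : {set I}) : uniq (positives X ++ negatives X).
Proof.
rewrite cat_uniq !enum_uniq andbT /=; apply/hasPn => i.
by rewrite !mem_enum !inE => /andP[-> ?] /=; rewrite -leNgt ltW.
Qed.

Lemma signs_sub (X : {set I}) : {subset positives X ++ negatives X <= X}.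
Proof. by move=> i; rewrite mem_cat !mem_enum !inE => /orP[] /andP[]. Qed.

Lemma sum_signs (X : {set I}) :
  \sum_(i <- positives X) v i + \sum_(i <- negatives X) v i = \sum_(i in X) v i.
Proof.
rewrite !big_enum /= [RHS](bigID (fun i => 0 < v i)) /=; congr (_ + _).
  by apply: eq_bigl => i; rewrite inE.
rewrite [RHS](bigID (fun i => v i < 0)) /= [X in _ = _ + X]big1 ?addr0.
  by apply: eq_bigl => i; rewrite inE; case: (i \in X) => //=; lia.
by move=> i; lia.
Qed.

(** The zigzag never compares elements of opposite signs, but leaves free the
    order within each sign.  Running it with an order and with the reverse
    order accounts for all the pairs, hence the factor 2. *)
Lemma same_sign_pairs_le (r : rel I) (X : {set I}) : irreflexive r ->
  (forall f, {in r f &, injective v}) ->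
  (forall f e, r f e -> ~~ is_subsum (X :\ f) (v e - v f)) ->
  - N%:Z <= \sum_(i in X) v i <= N%:Z ->
  (\sum_(f in X) \sum_(e in X | (0 < v f * v e)%R) r f e
     <= 2 * #|window_sums X 0|)%N.
Proof.
move=> r_irr rI rX sX.
set p := positives X; set q := negatives X.
have le_pairs p' q' : perm_eq p' p -> perm_eq q' q ->
    (ordered_pairs r p' + ordered_pairs r q' <= #|window_sums X 0|)%N.
  move=> pp qq.
  have pq : perm_eq (p' ++ q') (p ++ q) by apply: perm_cat.
  apply: leq_trans (ordered_pairs_le (X0 := X) rI rX (W := 0) _ _ _ _ _ _) _.
  - by rewrite (perm_all _ pp) positives_gt0.
  - by rewrite (perm_all _ qq) negatives_lt0.
  - by lia.
  - by rewrite add0r (perm_big _ pp) (perm_big _ qq) sum_signs.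
  - by rewrite (perm_uniq pq) signs_uniq.
  - by move=> i; rewrite (perm_mem pq); apply: signs_sub.
  apply/subset_leq_card/subsetP => b; rewrite !inE; apply: subsumS.
  by apply/subsetP => i; rewrite inE (perm_mem pq); apply: signs_sub.
rewrite mul2n -addnn.
apply: leq_trans (leq_add (le_pairs p q _ _) (le_pairs (rev p) (rev q) _ _)) => //;
  try by rewrite perm_rev.
rewrite addnACA !ordered_pairs_rev // !big_enum /=.
rewrite (bigID (fun i => 0 < v i)) /=; apply: leq_add.
  rewrite [leqRHS](eq_bigl (fun i => (i \in X) && (0 < v i))); last first.
    by move=> i; rewrite inE.
  apply: leq_sum => f /andP[_ f0]; rewrite big_enum /=.
  apply/eq_leq/eq_bigl => e; rewrite !inE; congr andb; exact: pmulr_rgt0.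
rewrite (bigID (fun i => v i < 0)) /= [X in (_ + X <= _)%N]big1 ?addn0.
  rewrite [leqRHS](eq_bigl (fun i => (i \in X) && (v i < 0))); last first.
    by move=> i; rewrite inE.
  rewrite (eq_bigl (fun i => (i \in X) && (v i < 0))); last first.
    by move=> i; case: (i \in X) => //=; lia.
  apply: leq_sum => f /andP[_ f0]; rewrite big_enum /=.
  apply/eq_leq/eq_bigl => e; rewrite !inE; congr andb; exact: nmulr_rgt0.
move=> f /andP[/andP[_ f0] f0']; have -> : v f = 0 by lia.
by rewrite big_pred0 // => e; rewrite mul0r ltxx andbF.
Qed.

(** Elements of value 0 are ignored: they appear when a family is padded to an
    even number of elements. *)
Definition irreducible_sum : Prop := forall J : {set I}, \sum_(i in J) v i = 0 ->
  {in J, forall i, v i = 0} \/ {in ~: J, forall i, v i = 0}.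

(** Here the additional value is the total [W] itself: [- v f] is not a subset
    sum of the elements left, since the element [i0] is kept aside and hence no
    zero-sum part can be everything. *)
Lemma irreducible_length : \sum_i v i = 0 -> irreducible_sum ->
  (#|[set i | v i != 0%R]| <= N.*2.+2)%N.
Proof.
move=> v0 irr; have [->|[i0]] := set_0Vmem [set i | v i != 0]; first by rewrite cards0.
rewrite inE => vi0; pose X := ~: [set i0].
pose Q p q W := uniq (p ++ q) -> {subset p ++ q <= X} ->
    {in p ++ q, forall i, v i != 0} ->
    (size p + size q <= #|window_sums [set i in p ++ q] W|)%N.
have step f s W : - N%:Z <= W <= N%:Z -> v f != 0 -> uniq (f :: s) ->
    {subset f :: s <= X} ->
    (#|window_sums [set i in s] (W + v f)| + 1
       <= #|window_sums [set i in f :: s] W|)%N.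
  move=> WN vf /= /andP[fs us] sX.
  have -> : [set i in s] = [set i in f :: s] :\ f.
    apply/setP => i; rewrite !inE; case: eqP => //= ->; exact: negbTE.
  rewrite -(cards1 tt).
  apply: (window_sums_gain (u := fun _ : unit => 0)) => [|x y _ _ _|||] //.
  - by rewrite inE mem_head.
  - by case: x; case: y.
  - by move=> ? _; rewrite addr0.
  - by move=> ? _; apply: subsum0.
  move=> _ _; apply/negP => /is_subsumP[A sA]; rewrite sub0r => sumA.
  have fA : f \notin A by apply/negP => /(subsetP sA); rewrite !inE eqxx.
  have : \sum_(i in f |: A) v i = 0 by rewrite big_setU1 //= sumA subrr.
  case/irr => zero; first by move: vf; rewrite zero ?eqxx // setU11.
  move: vi0; rewrite zero ?eqxx // !inE negb_or; apply/andP; split.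
    by apply: contraTneq (sX f (mem_head _ _)) => <-; rewrite !inE eqxx.
  apply/negP => /(subsetP sA); rewrite !inE => /andP[_ i0s].
  by move: (sX i0); rewrite inE i0s => /(_ isT); rewrite !inE eqxx.
have sX : \sum_(i in X) v i = - v i0.
  by move: v0; rewrite (bigD1 i0) //= => /eqP; rewrite addrC addr_eq0 => /eqP <-;
     apply: eq_bigl => i; rewrite !inE.
have : Q (positives X) (negatives X) 0.
  apply: zigzag_ind => [//|f p q W WN _ IH u sub nz|f p q W WN _ IH||||].
  - rewrite /= addSn -addn1.
    apply: leq_trans (step f (p ++ q) W WN (nz f (mem_head _ _)) u sub).
    rewrite leq_add2r; apply: IH; first by case/andP: u.
      by move=> i ipq; rewrite sub // inE ipq orbT.
    by move=> i ipq; rewrite nz // inE ipq orbT.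
  - rewrite /Q => u sub nz.
    have perm : perm_eq (p ++ f :: q) (f :: (p ++ q)).
      by rewrite perm_catC /= perm_cons perm_catC.
    have -> : [set i in p ++ f :: q] = [set i in f :: (p ++ q)].
      by apply/setP => i; rewrite !inE (perm_mem perm).
    have sub' : {subset f :: (p ++ q) <= X}.
      by move=> i; rewrite -(perm_mem perm); apply: sub.
    have nz' : {in f :: (p ++ q), forall i, v i != 0}.
      by move=> i; rewrite -(perm_mem perm); apply: nz.
    have u' : uniq (f :: (p ++ q)) by rewrite -(perm_uniq perm).
    rewrite /= addnS -addn1.
    apply: leq_trans (step f (p ++ q) W WN (nz' f (mem_head _ _)) u' sub').
    rewrite leq_add2r; apply: IH; first by case/andP: u'.
      by move=> i ipq; rewrite sub' // inE ipq orbT.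
    by move=> i ipq; rewrite nz' // inE ipq orbT.
  - exact: positives_gt0.
  - exact: negatives_lt0.
  - by rewrite oppr_le0 /=.
  - by rewrite add0r sum_signs sX; have := v_bound i0; lia.
have nz : {in positives X ++ negatives X, forall i, v i != 0}.
  by move=> i; rewrite mem_cat !mem_enum !inE => /orP[] /andP[_]; lia.
move=> /(_ (signs_uniq X) (@signs_sub X) nz) le_n.
apply: leq_trans (_ : #|i0 |: [set i in positives X ++ negatives X]| <= _)%N.
  apply/subset_leq_card/subsetP => i; rewrite !inE mem_cat !mem_enum !inE.
  by rewrite neq_lt orbC; case: (i =P i0).
rewrite cardsU1 -[(_.*2).+2]add1n; apply: leq_add; first by case: (_ \notin _).
rewrite cardsE (card_uniqP (signs_uniq X)) size_cat (leq_trans le_n) //.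
by rewrite (leq_trans (max_card _)) // card_ord.
Qed.

End SubsetSums.

(** * Splitting a zero-sum family into two halves *)

Section BalancedHalves.
Variables (h N : nat) (v : 'I_h * bool -> int).
Local Notation I := ('I_h * bool)%type.
Hypothesis v_bound : forall i, - N%:Z <= v i <= N%:Z.
Hypothesis v_le : forall j, v (j, false) <= v (j, true).
Hypothesis v_gaps : \sum_j (v (j, true) - v (j, false)) <= 2 * N%:Z.
Hypothesis v_sum : \sum_i v i = 0.
Hypothesis v_irr : irreducible_sum v.

(** A family indexed by ['I_h * bool] is a list of [h] pairs, and a half takes
    one element of each pair. *)
Definition half (eps : {ffun 'I_h -> bool}) : {set I} :=
  [set i | i.2 == eps i.1].

Definition opposite (eps : {ffun 'I_h -> bool}) : {ffun 'I_h -> bool} :=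
  [ffun j => ~~ eps j].

Lemma oppositeK : involutive opposite.
Proof. by move=> eps; apply/ffunP => j; rewrite !ffunE negbK. Qed.

Lemma half_opposite eps : half (opposite eps) = ~: half eps.
Proof. by apply/setP => -[j b]; rewrite !inE ffunE /=; case: b (eps j) => [] []. Qed.

Lemma sum_half eps : \sum_(i in half eps) v i = \sum_j v (j, eps j).
Proof.
rewrite big_mkcond (eq_bigr (fun i : I => (fun j b => if b == eps j then v (j, b) else 0) i.1 i.2)).
  rewrite -(pair_bigA _ (fun j b => if b == eps j then v (j, b) else 0)) /=.
  by apply: eq_bigr => j _; rewrite big_bool /=; case: (eps j); rewrite ?add0r ?addr0.
by move=> [j b] _; rewrite inE.
Qed.

Lemma sum_half_opposite eps :
  \sum_(i in half (opposite eps)) v i = - \sum_(i in half eps) v i.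
Proof.
have := v_sum; rewrite (bigID (mem (half eps))) /= half_opposite.
move=> /eqP; rewrite addrC addr_eq0 => /eqP <-.
by apply: eq_bigl => i; rewrite inE.
Qed.

(** Twice the total of a half is the difference between this half and the
    opposite one, which is a signed sum of the gaps within the pairs. *)
Lemma sum_half_bound eps : - N%:Z <= \sum_(i in half eps) v i <= N%:Z.
Proof.
have := sum_half_opposite eps; rewrite !sum_half.
set s := \sum_j v (j, eps j) => opp.
have : `|\sum_j (v (j, eps j) - v (j, opposite eps j))| <= 2 * N%:Z.
  apply: le_trans (ler_norm_sum _ _ _) (le_trans _ v_gaps); apply: ler_sum => j _.
  by rewrite ffunE; have := v_le j; case: (eps j) => /=; lia.
by rewrite sumrB opp -/s; lia.
Qed.

(** If [C] lies in a half, [C'] in the opposite one and [v C = - v C'], then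
    the union of [C] and [C'] has sum zero, so that it is empty or everything up
    to zeros.  So the two sets of sums, one of them reflected, share at most the
    values 0 and [v (half eps)]. *)
Lemma window_sums_half eps :
  (#|window_sums v N (half eps) 0| + #|window_sums v N (half (opposite eps)) 0|
     <= N.*2.+3)%N.
Proof.
set A := window_sums _ _ _ _; set B := window_sums _ _ _ _.
rewrite -(card_imset (mem B) (@rev_ord_inj _)) -cardsUI.
have -> : N.*2.+3 = (N.*2.+1 + 2)%N by rewrite addn2.
apply: leq_add; first by rewrite (leq_trans (max_card _)) ?card_ord.
have [c0 c0E] := @window_onto N 0 (ltac:(lia)).
have [c1 c1E] := window_onto (sum_half_bound eps).
have card2 : (#|[set c0; c1]| <= 2)%N by rewrite cards2; case: (_ != _).
apply: leq_trans card2; apply/subset_leq_card/subsetP => b /setIP[+ /imsetP[b' + bE]].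
rewrite !inE !subr0 => /is_subsumP[C sC sumC] /is_subsumP[C' sC' sumC'].
have opp_b : window_val b' = - window_val b.
  by rewrite bE /window_val /=; have := ltn_ord b'; lia.
have dis : [disjoint C & C'].
  rewrite disjoint_subset; apply/subsetP => i /(subsetP sC) iU.
  by rewrite !inE; apply/negP => /(subsetP sC'); rewrite half_opposite inE iU.
have sumU : \sum_(i in C :|: C') v i = 0.
  by rewrite (sum_setU_disjoint _ dis) /= sumC sumC' opp_b subrr.
case: (v_irr sumU) => zero.
  apply/orP; left; apply/eqP/(@window_inj N); rewrite c0E -sumC big1 // => i iC.
  by rewrite zero // inE iC.
apply/orP; right; apply/eqP/(@window_inj N); rewrite c1E -sumC.
rewrite [RHS](big_setID C) /= (setIidPr sC) [X in _ + X]big1 ?addr0 //.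
move=> i /setDP[iU iC]; rewrite zero // !inE negb_or iC /=.
by apply/negP => /(subsetP sC'); rewrite half_opposite inE iU.
Qed.

Variable D : {set I}.
Hypothesis D_inj : {in D &, injective v}.
Hypothesis D_neq0 : {in D, forall i, v i != 0}.

Definition both_in (f e : I) : {set {ffun 'I_h -> bool}} :=
  [set eps | (f \in half eps) && (e \in half eps)].

(** The halves in which the pair (f, e) contributes a subset sum. *)
Definition unlinked (f e : I) : {set {ffun 'I_h -> bool}} :=
  [set eps in both_in f e | ~~ is_subsum v (half eps :\ f) (v e - v f)].

(** Keep the pairs of [f] and [e] and flip all the others.  If (f, e) does not
    contribute before the flip and (e, f) does not contribute after it, then
    [v e - v f] and [v f - v e] are sums of disjoint sets that avoid [e] and
    [f], and their union is a zero-sum part that misses [e]. *)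
Lemma unlinked_exchange f e : f \in D -> e \in D -> f.1 != e.1 ->
  (#|both_in f e| <= #|unlinked f e| + #|unlinked e f|)%N.
Proof.
move=> fD eD fe1.
have fe : f != e by apply: contraNneq fe1 => ->.
pose flip (eps : {ffun 'I_h -> bool}) : {ffun 'I_h -> bool} :=
  [ffun j => if (j == f.1) || (j == e.1) then eps j else ~~ eps j].
have flipK : involutive flip.
  by move=> eps; apply/ffunP => j; rewrite !ffunE; case: (_ || _); rewrite ?negbK.
rewrite -(cardsID (unlinked f e) (both_in f e)); apply: leq_add.
  exact/subset_leq_card/subsetIr.
rewrite -(card_imset _ (inv_inj flipK)).
apply/subset_leq_card/subsetP => _ /imsetP[eps /setDP[bi nu] ->].
have /is_subsumP[C sC sumC] : is_subsum v (half eps :\ f) (v e - v f).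
  by apply: contraR nu => nsub; rewrite inE bi.
move: bi; rewrite !inE !ffunE !eqxx orbT /= => /andP[fU eU]; rewrite eU fU /=.
apply/negP => /is_subsumP[C' sC' sumC'].
(* If e were in C, exchanging it for f would give a zero-sum part. *)
have eC : e \notin C.
  apply/negP => eC; have : \sum_(i in f |: (C :\ e)) v i = 0.
    rewrite big_setU1 /=; last first.
      by rewrite !inE negb_and; apply/orP; right; apply/negP => /(subsetP sC); rewrite !inE eqxx.
    by move: sumC; rewrite (big_setD1 e) //= => /addrI ->; rewrite subrr.
  case/v_irr => zero; first by move: (D_neq0 fD); rewrite zero ?eqxx // setU11.
  by move: (D_neq0 eD); rewrite zero ?eqxx // !inE eqxx eq_sym (negbTE fe).
have fC' : f \notin C'.
  apply/negP => fC'; have : \sum_(i in e |: (C' :\ f)) v i = 0.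
    rewrite big_setU1 /=; last first.
      by rewrite !inE negb_and; apply/orP; right; apply/negP => /(subsetP sC'); rewrite !inE eqxx.
    by move: sumC'; rewrite (big_setD1 f) //= => /addrI ->; rewrite subrr.
  case/v_irr => zero; first by move: (D_neq0 eD); rewrite zero ?eqxx // setU11.
  by move: (D_neq0 fD); rewrite zero ?eqxx // !inE eqxx (negbTE fe).
(* A half and its flip have no other common elements than f and e. *)
have dis : [disjoint C & C'].
  rewrite disjoint_subset; apply/subsetP => i iC; rewrite !inE; apply/negP => iC'.
  have := subsetP sC _ iC; have := subsetP sC' _ iC'; rewrite !inE ffunE.
  case: ifP => [|_ /andP[_ /eqP->] /andP[_ /eqP]]; last by case: (eps _).
  case: i iC iC' => j b iC iC' /= /orP[] /eqP ji /andP[_ /eqP bE] _.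
    have iE : (j, b) = f by rewrite bE ji -(eqP fU); case: (f).
    by rewrite -iE iC' in fC'.
  have iE : (j, b) = e by rewrite bE ji -(eqP eU); case: (e).
  by rewrite -iE iC in eC.
have sumU : \sum_(i in C :|: C') v i = 0.
  by rewrite (sum_setU_disjoint _ dis) sumC sumC' addrC subrKA subrr.
case: (v_irr sumU) => zero.
  have C0 : \sum_(i in C) v i = 0 by rewrite big1 // => i iC; rewrite zero // inE iC.
  have vfe : v f = v e by apply/esym/eqP; rewrite -subr_eq0 -sumC C0.
  by rewrite (D_inj fD eD vfe) eqxx in fe.
move: (D_neq0 eD); rewrite zero ?eqxx // !inE negb_or eC /=.
by apply/negP => /(subsetP sC'); rewrite !inE eqxx.
Qed.

(** Overwriting the two coordinates of [eps] that matter loses two bits. *)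
Lemma card_both_in f e : f.1 != e.1 -> (2 ^ h <= 4 * #|both_in f e|)%N.
Proof.
move=> fe1.
pose g (eps : {ffun 'I_h -> bool}) : {ffun 'I_h -> bool} * (bool * bool) :=
  ([ffun j => if j == f.1 then f.2 else if j == e.1 then e.2 else eps j],
   (eps f.1, eps e.1)).
have g_inj : injective g.
  move=> x y [/ffunP xy xf xe]; apply/ffunP => j.
  have [->//|jf] := eqVneq j f.1; have [->//|je] := eqVneq j e.1.
  by have := xy j; rewrite !ffunE (negbTE jf) (negbTE je).
have := card_imset [set: {ffun 'I_h -> bool}] g_inj.
rewrite cardsT card_ffun card_bool card_ord => <-.
apply: leq_trans (_ : #|setX (both_in f e) [set: bool * bool]| <= _)%N; last first.
  by rewrite cardsX cardsT card_prod card_bool mulnC.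
apply/subset_leq_card/subsetP => _ /imsetP[eps _ ->].
by rewrite !inE !ffunE !eqxx [e.1 == _]eq_sym (negbTE fe1) ?eqxx.
Qed.

(** Two elements of the same pair are never in the same half, and elements of
    opposite signs are not compared, so only these pairs can contribute. *)
Definition spread_pairs : {set I * I} :=
  [set fe | [&& fe.1 \in D, fe.2 \in D, fe.1.1 != fe.2.1 & 0 < v fe.1 * v fe.2]].

(** The opposite halves are summed together, by [window_sums_half]. *)
Lemma sum_unlinked_le :
  (\sum_(fe in spread_pairs) #|unlinked fe.1 fe.2| <= 2 ^ h * N.*2.+3)%N.
Proof.
have -> : (\sum_(fe in spread_pairs) #|unlinked fe.1 fe.2| =
   \sum_eps \sum_(fe in spread_pairs) (eps \in unlinked fe.1 fe.2))%N.
  rewrite exchange_big /=; apply: eq_bigr => fe _.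
  by rewrite -sum1_card big_mkcond /=; apply: eq_bigr => eps _; case: (_ \in _).
pose c eps := #|window_sums v N (half eps) 0|.
have le_c eps : (\sum_(fe in spread_pairs) (eps \in unlinked fe.1 fe.2) <= 2 * c eps)%N.
  pose r f e := [&& f \in D, e \in D, f.1 != e.1 &
                  ~~ is_subsum v (half eps :\ f) (v e - v f)].
  apply: leq_trans (same_sign_pairs_le (r := r) v_bound _ _ _ (sum_half_bound eps)).
  - rewrite pair_big_dep /= big_mkcond [leqRHS]big_mkcond /=.
    apply: leq_sum => -[f e] _; rewrite /= !inE /r /=.
    by case: (f \in D) (e \in D) (f.1 != e.1) (0 < v f * v e) (f.2 == _) (e.2 == _)
       => [] [] [] [] [] [].
  - by move=> f; rewrite /r eqxx !andbF.
  - move=> f e e' /and4P[_ eD _ _] /and4P[_ e'D _ _]; exact: D_inj.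
  - by move=> f e /and4P[].
apply: leq_trans (leq_sum _ (fun eps _ => le_c eps)) _.
rewrite -big_distrr /= mul2n -addnn.
rewrite [X in (_ + X <= _)%N](reindex_inj (inv_inj oppositeK)) /= -big_split /=.
apply: leq_trans (leq_sum _ (fun eps _ => window_sums_half eps)) _.
by rewrite sum_nat_const card_ffun card_bool card_ord.
Qed.

Lemma card_spread_pairs_le : (#|spread_pairs| <= 8 * N.*2.+3)%N.
Proof.
have le_sum : (#|spread_pairs| * 2 ^ h <=
     4 * \sum_(fe in spread_pairs) (#|unlinked fe.1 fe.2| + #|unlinked fe.2 fe.1|))%N.
  rewrite -sum_nat_const big_distrr /=; apply: leq_sum => -[f e].
  rewrite inE => /and4P[/= fD eD fe1 _].
  apply: leq_trans (card_both_in fe1) _; rewrite leq_mul2l /=.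
  exact: unlinked_exchange.
rewrite -(leq_pmul2r (expn_gt0 2 h)) (leq_trans le_sum) // big_split /=.
pose swap (fe : I * I) := (fe.2, fe.1).
have swapK : involutive swap by case.
have -> : (\sum_(fe in spread_pairs) #|unlinked fe.2 fe.1| =
           \sum_(fe in spread_pairs) #|unlinked fe.1 fe.2|)%N.
  rewrite (reindex_inj (inv_inj swapK)) /=; apply: eq_bigl => -[f e].
  rewrite !inE /= mulrC [e.1 == f.1]eq_sym.
  by case: (f \in D) (e \in D) => [] [].
by have := sum_unlinked_le; move: (\sum_(_ in _) _)%N => s; lia.
Qed.

(** At least half of the pairs of elements of [D] have the same sign, and for
    each element at most two of these pairs are not in [spread_pairs]: the pair
    it forms with itself and the one with the other element of its pair. *)
Lemma distinct_values_le : (#|D| ^ 2 <= 32 * N + 48 + 4 * #|D|)%N.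
Proof.
pose Ds (s : bool) := [set i in D | (0 < v i) == s].
have D_split : #|D| = (#|Ds true| + #|Ds false|)%N.
  rewrite -(cardsID [set i | 0 < v i] D); congr (_ + _)%N; apply: eq_card => i;
  by rewrite !inE; case: (i \in D) (0 < v i) => [] [].
have : (\sum_(f in D) #|Ds (0 < v f)%R| <= #|spread_pairs| + 2 * #|D|)%N.
  rewrite -[in leqRHS]sum1_card [in leqRHS](mulnC 2) -sum_nat_const.
  rewrite (eq_bigr (fun f => \sum_(e in Ds (0 < v f)%R) 1)%N) => [|f _]; last by rewrite sum1_card.
  rewrite [X in (_ <= X + _)%N](eq_bigl
      (fun fe : I * I => (fe.1 \in D) && ((fe.1, fe.2) \in spread_pairs))).
    rewrite -(pair_big_dep (mem D) (fun f e => (f, e) \in spread_pairs) (fun _ _ => 1%N)) /=.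
    rewrite -big_split /=; apply: leq_sum => f fD.
    rewrite !sum1_card.
    have sub : Ds (0 < v f)%R \subset
        [set e | (f, e) \in spread_pairs] :|: [set (f.1, true); (f.1, false)].
      apply/subsetP => -[j b]; rewrite !inE /= => /andP[eD sgn]; rewrite fD eD /=.
      have := D_neq0 fD; have := D_neq0 eD.
      have [->|fj] := eqVneq f.1 j; first by case: b {eD sgn}; rewrite ?eqxx ?orbT.
      move=> ve vf; apply/orP; left; move: sgn => /eqP.
      have [f0|f0] := ltrP 0 (v f); first by rewrite pmulr_rgt0 // => ->.
      have f0' : v f < 0 by rewrite lt_neqAle vf.
      by rewrite nmulr_rgt0 // => /negbT; rewrite -leNgt [_ < 0]lt_neqAle ve.
    apply: leq_trans (subset_leq_card sub) _.
    apply: leq_trans (leq_card_setU _ _) _.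
    rewrite cardsE leq_add2l cards2.
    by case: (_ != _).
  by move=> [f e]; rewrite inE /=; case: (f \in D).
have -> : (\sum_(f in D) #|Ds (0 < v f)%R| = #|Ds true| ^ 2 + #|Ds false| ^ 2)%N.
  rewrite (bigID (fun f => 0 < v f)) /=; congr (_ + _)%N.
    rewrite (eq_bigr (fun _ => #|Ds true|)) => [|f /andP[_ ->//]].
    rewrite sum_nat_cond_const; congr muln; apply: eq_card => i.
    by rewrite !inE; case: (0 < v i).
  rewrite (eq_bigr (fun _ => #|Ds false|)) => [|f /andP[_ /negbTE->//]].
  rewrite sum_nat_cond_const; congr muln; apply: eq_card => i.
  by rewrite !inE; case: (0 < v i).
have := card_spread_pairs_le; rewrite D_split.
move: #|spread_pairs| #|Ds true| #|Ds false| => s x y.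
have := (nat_Cauchy x y).1; rewrite sqrnD.
by move: (x ^ 2)%N (y ^ 2)%N (x * y)%N => x2 y2 xy; lia.
Qed.

End BalancedHalves.

(** * Irreducible multisets of weights *)

Lemma sum_evens_odds (V : zmodType) (G : nat -> V) (h : nat) :
  \sum_(i : 'I_h * bool) G (i.1.*2 + i.2)%N = \sum_(k < h.*2) G k.
Proof.
rewrite -(pair_bigA _ (fun (j : 'I_h) (b : bool) => G (j.*2 + b)%N)) /=.
elim: h => [|h IHh]; first by rewrite !big_ord0.
rewrite doubleS !big_ord_recr /= IHh big_bool /= -addrA; congr (_ + _).
by rewrite addrC addn0 addn1.
Qed.

(** For a monotone sequence the gaps between [a (2j)] and [a (2j + 1)] are
    disjoint. *)
Lemma sum_disjoint_gaps (a : nat -> int) (h : nat) : (0 < h)%N ->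
  (forall k, (k.+1 < h.*2)%N -> a k <= a k.+1) ->
  \sum_(j < h) (a (j.*2 + 1)%N - a (j.*2 + 0)%N) <= a h.*2.-1 - a 0%N.
Proof.
case: h => // h _; elim: h => [|h IHh] mono.
  by rewrite big_ord_recl big_ord0 addr0.
rewrite big_ord_recr /= addn0.
have := mono h.*2.+1; rewrite doubleS => /(_ (ltac:(lia))) le1.
have le2 : \sum_(j < h.+1) (a (j.*2 + 1)%N - a (j.*2 + 0)%N) <= a h.*2.+1 - a 0%N.
  by apply: IHh => k lt_k; apply: mono; lia.
apply: le_trans (lerD le2 (lexx _)) _.
by rewrite addn1 doubleS /=; lia.
Qed.

Section Multiplicities.
Variables (K : finType) (w : K -> int) (N : nat).
Hypothesis w_inj : injective w.
Hypothesis w_bound : forall i, - N%:Z <= w i <= N%:Z.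

Definition total_weight (m : K -> nat) : int := \sum_i w i *+ m i.

Definition irreducible_mult (m : K -> nat) : Prop :=
  total_weight m = 0 /\ forall m' : K -> nat, (forall i, m' i <= m i)%N ->
    total_weight m' = 0 -> m' =1 (fun=> 0%N) \/ m' =1 m.

(** A multiset with an irreducible multiplicity function is listed in
    increasing order, after adding one 0 if its size is odd, and cut into
    consecutive pairs; this gives a family to which the bounds of the previous
    part apply.  A set [J] of positions defines the multiplicities [fiber J],
    which transfers irreducibility from [m] to the family. *)
Section SortedPairs.
Variable m : K -> nat.
Hypothesis m_irr : irreducible_mult m.

Let s0 := flatten [seq nseq (m i) (w i) | i <- enum K].
Let s := if odd (size s0) then 0 :: s0 else s0.
Let a := sort <=%O s.
Let h := (size a)./2.
Let v (k : 'I_h * bool) : int := nth 0 a (k.1.*2 + k.2).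

Let size_a : size a = h.*2.
Proof.
rewrite -[LHS]odd_double_half -/h.
suff -> : odd (size a) = false by [].
by rewrite size_sort /s; case: ifP => //= ->.
Qed.

Let lt_size (k : 'I_h * bool) : (k.1.*2 + k.2 < size a)%N.
Proof. by rewrite size_a; have := ltn_ord k.1; case: (k.2) => /=; lia. Qed.

Let sum_v (V : zmodType) (F : int -> V) : \sum_k F (v k) = \sum_(x <- s) F x.
Proof.
rewrite (sum_evens_odds (fun k => F (nth 0 a k))) -size_a.
rewrite -(big_mkord xpredT (fun k => F (nth 0 a k))) -(big_nth 0 xpredT F).
by apply: perm_big; rewrite perm_sort.
Qed.

Let sum_s0 (V : zmodType) (F : int -> V) :
  \sum_(x <- s0) F x = \sum_i F (w i) *+ m i.
Proof.
rewrite big_flatten big_map big_enum /=; apply: eq_bigr => i _.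
by rewrite big_nseq iter_addr_0.
Qed.

Let sum_v_mult (V : zmodType) (F : int -> V) : F 0 = 0 ->
  \sum_k F (v k) = \sum_i F (w i) *+ m i.
Proof.
by move=> F0; rewrite sum_v /s; case: ifP => _; rewrite ?big_cons ?F0 ?add0r sum_s0.
Qed.

Let v_val k : v k = 0 \/ exists2 i, v k = w i & (0 < m i)%N.
Proof.
have : v k \in s by rewrite -(mem_sort <=%O); apply: mem_nth; apply: lt_size.
have v_s0 : v k \in s0 -> exists2 i, v k = w i & (0 < m i)%N.
  case/flattenP => _ /mapP[i _ ->]; rewrite mem_nseq => /andP[mi /eqP vi].
  by exists i.
rewrite /s; case: ifP => _; last by right; apply: v_s0.
by rewrite inE => /orP[/eqP|/v_s0]; [left | right].
Qed.

Let v_bound k : - N%:Z <= v k <= N%:Z.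
Proof. by have [->|[i -> _]] := v_val k; [lia | apply: w_bound]. Qed.

Let mono_a k : (k.+1 < h.*2)%N -> nth 0 a k <= nth 0 a k.+1.
Proof.
move=> lt_k; apply: (sortedP 0 (sort_sorted (@le_total _ _) s)).
by rewrite -/a size_a.
Qed.

Let v_le j : v (j, false) <= v (j, true).
Proof.
rewrite /v /= addn0 addn1; apply: mono_a.
by have := ltn_ord j; lia.
Qed.

Let v_gaps : \sum_j (v (j, true) - v (j, false)) <= 2 * N%:Z.
Proof.
have [h0|h0] := posnP h.
  rewrite big1 => [|j _]; first by lia.
  by have := ltn_ord j; rewrite {2}h0.
apply: le_trans (sum_disjoint_gaps h0 mono_a) _.
have a_bound k : - N%:Z <= nth 0 a k <= N%:Z.
  have [lt_k|ge_k] := ltnP k (size a); last by rewrite nth_default //; lia.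
  have kh : (k./2 < h)%N by move: lt_k; rewrite size_a; lia.
  by have := v_bound (Ordinal kh, odd k); rewrite /v /= addnC odd_double_half.
by have := a_bound h.*2.-1; have := a_bound 0%N; lia.
Qed.

Let v_sum : \sum_k v k = 0.
Proof. by rewrite (sum_v_mult (F := id)) //; case: m_irr. Qed.

Let fiber (J : {set 'I_h * bool}) (i : K) : nat :=
  if w i == 0 then 0%N else #|[set k in J | v k == w i]|.

Let fiber_all i : w i != 0 -> #|[set k | v k == w i]| = m i.
Proof.
move=> wi; have := @sum_v_mult int (fun x => (x == w i)%:R).
rewrite eq_sym (negbTE wi) => /(_ erefl) E.
apply/eqP; rewrite -(eqr_nat int) -sum1_card natr_sum big_mkcond /=.
apply/eqP; transitivity (\sum_k (v k == w i)%:R : int).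
  by apply: eq_bigr => k _; rewrite inE; case: (v k == w i).
rewrite E (bigD1 i) //= eqxx big1 ?addr0 // => j ji.
by rewrite (inj_eq w_inj) (negbTE ji) mul0rn.
Qed.

Let fiber_le J i : (fiber J i <= m i)%N.
Proof.
rewrite /fiber; case: eqVneq => // wi; rewrite -(fiber_all wi).
by apply/subset_leq_card/subsetP => k; rewrite !inE => /andP[].
Qed.

Let fiber_weight J : total_weight (fiber J) = \sum_(k in J) v k.
Proof.
rewrite [RHS](eq_bigr (fun k => \sum_i (if v k == w i then w i else 0))).
  rewrite exchange_big /=; apply: eq_bigr => i _.
  rewrite /fiber; case: eqVneq => [->|wi].
    by rewrite mulr0n big1 // => k _; case: ifP.
  rewrite -big_mkcondr /= sumr_const; congr (_ *+ _).
  by apply: eq_card => k; rewrite !inE.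
move=> k _; have [vk|[i vk mi]] := v_val k.
  by rewrite big1 // => i _; rewrite vk; case: eqP.
rewrite (bigD1 i) //= vk eqxx big1 ?addr0 // => j ji.
by rewrite (inj_eq w_inj) eq_sym (negbTE ji).
Qed.

Let v_irr : irreducible_sum v.
Proof.
move=> J sumJ; have [_ irr] := m_irr.
case: (irr (fiber J) (fiber_le J)); first by rewrite fiber_weight.
  move=> fib0; left => k kJ; have [//|[i vk mi]] := v_val k.
  have := fib0 i; rewrite /fiber; case: eqP => [wi|_ /eqP]; first by rewrite vk.
  by rewrite cards_eq0 => /eqP/setP/(_ k); rewrite !inE kJ vk eqxx.
move=> fibm; right => k; rewrite inE => kJ; have [//|[i vk mi]] := v_val k.
have [//|vk0] := eqVneq (v k) 0; have wi : w i != 0 by rewrite -vk.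
have := fibm i; rewrite /fiber (negbTE wi) -(fiber_all wi) => eq_card.
have sub : [set k' in J | v k' == w i] \subset [set k' | v k' == w i].
  by apply/subsetP => k'; rewrite !inE => /andP[].
have /(subset_cardP eq_card) /(_ k) := sub.
by rewrite !inE (negbTE kJ) vk eqxx.
Qed.

Lemma irreducible_nonzero_length :
  (\sum_(i | w i != 0%R) m i <= N.*2.+2)%N.
Proof.
apply: leq_trans (irreducible_length v_bound v_sum v_irr).
rewrite -(ler_nat int) natr_sum -sum1_card natr_sum.
rewrite [leRHS]big_mkcond [leLHS]big_mkcond /=.
have F0 : (if (0 : int) != 0 then 1 else 0 : int) = 0 by rewrite eqxx.
rewrite le_eqVlt; apply/orP; left; apply/eqP/esym.
transitivity (\sum_k (if v k != 0 then 1 else 0 : int)).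
  by apply: eq_bigr => k _; rewrite inE.
rewrite (sum_v_mult (F := fun x => if x != 0 then 1 else 0 : int)) //.
by apply: eq_bigr => i _; case: ifP => //; rewrite mul0rn.
Qed.

Lemma irreducible_nonzero_support (t := #|[set i | (w i != 0%R) && (0 < m i)%N]|) :
  (t ^ 2 <= 32 * N + 48 + 4 * t)%N.
Proof.
rewrite /t {t}; set A := [set i | _].
have hit i : i \in A -> {k | v k == w i}.
  rewrite inE => /andP[wi mi]; apply/sigW.
  have : (0 < #|[set k | v k == w i]|)%N by rewrite fiber_all.
  by rewrite card_gt0 => /set0Pn[k]; rewrite inE; exists k.
have [A0|[i0 i0A]] := set_0Vmem A; first by rewrite A0 cards0.
pose f i := odflt (sval (hit i0 i0A)) [pick k | v k == w i].
have fE i : i \in A -> v (f i) = w i.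
  move=> /hit[k vk]; rewrite /f; case: pickP => [k' /eqP //|/(_ k)].
  by rewrite vk.
have f_inj : {in A &, injective f}.
  by move=> i j iA jA /(congr1 v); rewrite !fE //; apply: w_inj.
rewrite -(card_in_imset f_inj).
apply: (distinct_values_le v_bound v_le v_gaps v_sum v_irr).
  move=> _ _ /imsetP[i iA ->] /imsetP[j jA ->].
  by rewrite !fE // => /w_inj ->.
by move=> _ /imsetP[i iA ->]; rewrite fE //; move: iA; rewrite inE => /andP[].
Qed.

(** An element of weight zero is by itself a zero-sum part. *)
Lemma irreducible_zero_weight i0 : w i0 = 0 -> (0 < m i0)%N ->
  m =1 (fun i => (i == i0) : nat).
Proof.
move=> w0 m0; have [_ irr] := m_irr.
have [||E i|E i] := irr (fun i => (i == i0) : nat); last by rewrite E.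
- by move=> i; case: eqP => // ->.
- by rewrite /total_weight (bigD1 i0) //= eqxx w0 mul0rn big1 // => i /negbTE ->.
- by have := E i0; rewrite eqxx.
Qed.

Theorem irreducible_support (t := #|[set i | (0 < m i)%N]|) :
  (t ^ 2 <= 32 * N + 48 + 4 * t)%N.
Proof.
rewrite /t {t}.
have [i0 /andP[/eqP w0 m0]|no0] := pickP [pred i | (w i == 0) && (0 < m i)%N].
  rewrite (_ : [set i | _] = [set i0]) ?cards1 //; last first.
    by apply/setP => i; rewrite !inE (irreducible_zero_weight w0 m0); case: eqP.
  by lia.
rewrite (_ : [set i | _] = [set i | (w i != 0) && (0 < m i)%N]).
  exact: irreducible_nonzero_support.
by apply/setP => i; rewrite !inE; have := no0 i; rewrite /=; case: (w i == 0).
Qed.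

Theorem irreducible_degree : (\sum_i m i <= N.*2.+2)%N.
Proof.
have [i0 /andP[/eqP w0 m0]|no0] := pickP [pred i | (w i == 0) && (0 < m i)%N].
  rewrite (bigD1 i0) //= big1 => [|i ii0].
    by rewrite (irreducible_zero_weight w0 m0) eqxx.
  by rewrite (irreducible_zero_weight w0 m0) (negbTE ii0).
apply: leq_trans irreducible_nonzero_length.
rewrite (bigID (fun i => w i == 0)) /= big1 // => i wi.
by have := no0 i; rewrite /= wi lt0n; case: (m i).
Qed.

End SortedPairs.
End Multiplicities.

(** * Counting sparse multisets by a generating function *)

(** The number of distinct weights of a multiset given by multiplicities. *)
Definition nsupp (n b : nat) (m : {ffun 'I_n -> 'I_b}) : nat :=
  #|[set i | (0 < m i)%N]|.

(** The multisets that satisfy the bounds of [irreducible_support] and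
    [irreducible_degree] for weights in [-n, n]. *)
Definition sparse_mults (n : nat) : {set {ffun 'I_n.+1 -> 'I_(n.*2.+3)}} :=
  [set m : {ffun 'I_n.+1 -> 'I_(n.*2.+3)} |
     (nsupp m ^ 2 <= 32 * n + 48 + 4 * nsupp m)%N && (\sum_i m i <= n.*2.+2)%N].

(** The sum is the product over the coordinates of
    [1 + y (z + z^2 + ... + z^b)]. *)
Lemma sum_weight_mults (R : realFieldType) (n b : nat) (y z : R) :
  0 < y -> 0 < z < 1 ->
  \sum_(m : {ffun 'I_n -> 'I_b.+1}) y ^+ nsupp m * z ^+ (\sum_i m i)%N
    <= (1 + y / (1 - z)) ^+ n.
Proof.
move=> y0 /andP[z0 z1]; have sz : 0 < 1 - z by rewrite subr_gt0.
pose g (j : 'I_b.+1) := if (0 < j)%N then y * z ^+ j else 1.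
have g_ge0 j : 0 <= g j.
  by rewrite /g; case: ifP => // _; rewrite mulr_ge0 ?exprn_ge0 ?ltW.
rewrite (eq_bigr (fun m : {ffun 'I_n -> 'I_b.+1} => \prod_i g (m i))); last first.
  move=> m _; rewrite -prodrXr /nsupp -sum1_card -prodrXr big_mkcond /=.
  rewrite -big_split /=; apply: eq_bigr => i _.
  by rewrite inE /g expr1; case: (posnP (m i)) => [->|//]; rewrite expr0 mulr1.
rewrite -(bigA_distr_bigA (fun _ => g)) /= prodr_const card_ord.
apply: lerXn2r; rewrite ?nnegrE ?sumr_ge0 //.
  by rewrite addr_ge0 // divr_ge0 // ltW.
rewrite big_ord_recl /g /= lerD2l.
rewrite (eq_bigr (fun j : 'I_b => y * z * z ^+ j)) => [|j _]; last by rewrite exprS mulrA.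
have geo : (1 - z) * (\sum_(j < b) z ^+ j) = 1 - z ^+ b.
  by rewrite -[LHS]opprK -mulNr opprB -subrX1 opprB.
rewrite -mulr_sumr ler_pdivlMr // -!mulrA [_ * (1 - z)]mulrC geo.
rewrite -[leRHS]mulr1 ler_pM2l // mulrBr mulr1 lerBlDr (le_trans (ltW z1)) //.
by rewrite lerDl mulr_ge0 ?exprn_ge0 // ltW.
Qed.

(** * Invariants of the torus and their generators *)

Lemma sum_base_inj (B n : nat) (f g : 'I_n -> nat) :
  (forall i, f i < B)%N -> (forall i, g i < B)%N ->
  (\sum_(i < n) f i * B ^ i = \sum_(i < n) g i * B ^ i)%N -> f =1 g.
Proof.
elim: n f g => [|n IHn] f g fB gB; first by move=> _ [].
rewrite !big_ord_recl /= !expn0 !muln1.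
have shift (u : 'I_n.+1 -> nat) : (\sum_(i < n) u (lift ord0 i) * B ^ bump 0 i =
    (\sum_(i < n) u (lift ord0 i) * B ^ i) * B)%N.
  by rewrite big_distrl /=; apply: eq_bigr => i _; rewrite expnS mulnCA mulnC.
rewrite !shift => E.
have B0 : (0 < B)%N := leq_ltn_trans (leq0n _) (fB ord0).
have E0 : f ord0 = g ord0.
  by have := congr1 (modn^~ B) E; rewrite /= ![(_ + _ * B)%N]addnC !modnMDl !modn_small.
move/eqP: E; rewrite E0 eqn_add2l eqn_pmul2r // => /eqP E.
have Elift := IHn (fun i => f (lift ord0 i)) (fun i => g (lift ord0 i))
                  (fun i => fB _) (fun i => gB _) E.
by move=> i; case: (unliftP ord0 i) => [j ->|->].
Qed.

Lemma natr_inj (k : fieldType) : [pchar k] =i pred0 ->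
  injective (fun i : nat => i%:R : k).
Proof.
move=> char0 i j /= ij; wlog le_ij : i j ij / (i <= j)%N.
  by move=> wl; case/orP: (leq_total i j) => /wl ->.
apply/eqP; rewrite eqn_leq le_ij /= -subn_eq0.
by rewrite -((pcharf0P k).1 char0) natrB // ij subrr.
Qed.

Module Invariants.
Import mpoly.

(** Kronecker substitution: replacing ['X_i] by ['X^(B ^ i)] with [B] larger
    than the degree keeps distinct monomials distinct, and a univariate
    polynomial that vanishes on a field of characteristic 0 is zero. *)
Lemma meval_eq0 (k : fieldType) (char0 : [pchar k] =i pred0) (n : nat)
    (p : {mpoly k[n]}) : (forall c : 'I_n -> k, p.@[c] = 0) -> p = 0.
Proof.
move=> p0; apply/mpolyP => m; rewrite mcoeff0; apply/eqP.
rewrite mcoeff_eq0; apply/negP => m_p.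
pose code (m : 'X_{1..n}) := (\sum_(i < n) m i * msize p ^ i)%N.
pose q : {poly k} := \sum_(m <- msupp p) p@_m *: 'X^(code m).
have lt_size m' i : m' \in msupp p -> (m' i < msize p)%N.
  move=> /msize_mdeg_lt; apply: leq_ltn_trans.
  by rewrite mdegE (bigD1 i) //= leq_addr.
have q_eval x : q.[x] = 0.
  rewrite -(p0 (fun i => x ^+ (msize p ^ i))) mevalE horner_sum.
  apply: eq_bigr => m' _; rewrite hornerZ hornerXn; congr (_ * _).
  by rewrite -prodrXr; apply: eq_bigr => i _; rewrite -exprM mulnC.
have q0 : q = 0.
  apply/eqP; apply: contraT => q_neq0.
  pose rs : seq k := [seq i%:R | i <- iota 0 (size q)].
  have rs_uniq : uniq rs.
    by rewrite map_inj_uniq ?iota_uniq //; apply: natr_inj.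
  have := max_poly_roots q_neq0 _ rs_uniq.
  rewrite size_map size_iota ltnn => /(_ _)-> //.
  by apply/allP => x _; apply/eqP/q_eval.
have := congr1 (fun q : {poly k} => q`_(code m)) q0.
rewrite coef0 coef_sum (bigD1_seq m) //= coefZ coefXn eqxx mulr1.
rewrite big_seq_cond big1 => [|m' /andP[m'_p m'm]].
  by rewrite addr0 => /eqP; rewrite mcoeff_eq0 m_p.
rewrite coefZ coefXn; case: eqP => [E|]; last by rewrite mulr0.
case/eqP: m'm; apply/mnmP => i; symmetry.
by apply: sum_base_inj E i => i; apply: lt_size.
Qed.

Lemma mcoeff_form_act (k : fieldType) (t : 'M[k]_2) (f : {mpoly k[2]})
    (m : 'X_{1..2}) : is_diag_mx t ->
  (form_act t f)@_m = t 0 0 ^+ m 0 * t 1 1 ^+ m 1 * f@_m.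
Proof.
move=> /is_diag_mxP diag_t.
have actX j : \sum_(i < 2) t i j *: 'X_i = t j j *: 'X_j :> {mpoly k[2]}.
  rewrite (bigD1 j) //= big1 ?addr0 // => i ij.
  by rewrite diag_t ?scale0r.
rewrite /form_act comp_mpolyE (raddf_sum (mcoeff m)) /=.
rewrite [in RHS](mpolyE f) (raddf_sum (mcoeff m)) /= big_distrr /=.
apply: eq_bigr => m' _; rewrite !mcoeffZ mulrCA; congr (_ * _).
rewrite (eq_bigr (fun i => t i i ^+ m' i *: 'X_i ^+ m' i)) => [|i _].
  rewrite scaler_prod -mpolyXE_id mcoeffZ mcoeffX.
  case: eqP => [->|]; last by rewrite !mulr0.
  rewrite !mulr1 !big_ord_recl big_ord0 mulr1.
  by congr (t _ _ ^+ m _ * t _ _ ^+ m _); apply: val_inj.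
by rewrite tnth_mktuple actX exprZn.
Qed.

Lemma det_diag2 (k : fieldType) (t : 'M[k]_2) : is_diag_mx t ->
  \det t = t 0 0 * t 1 1.
Proof.
move=> diag_t; rewrite det_trig ?is_diag_mx_is_trig // !big_ord_recl big_ord0 mulr1.
by congr (t _ _ * t _ _); apply: val_inj.
Qed.

Section Fixed.
Variables (k : fieldType) (char0 : [pchar k] =i pred0) (n : nat).

Definition xdeg (m : 'X_{1..n.+1}) : nat := (\sum_(i < n.+1) i * m i)%N.
Definition ydeg (m : 'X_{1..n.+1}) : nat := (\sum_(i < n.+1) (n - i) * m i)%N.
(** The diagonal matrix with entries [a] and [d] multiplies the monomial [m] by
    [a ^ xdeg m * d ^ ydeg m], and [a * d = 1]; so [m] has weight
    [xdeg m - ydeg m]. *)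
Definition balanced (m : 'X_{1..n.+1}) : bool := xdeg m == ydeg m.

Lemma xdegD m1 m2 : xdeg (m1 + m2) = (xdeg m1 + xdeg m2)%N.
Proof. by rewrite -big_split; apply: eq_bigr => i _; rewrite mnmDE mulnDr. Qed.

Lemma ydegD m1 m2 : ydeg (m1 + m2) = (ydeg m1 + ydeg m2)%N.
Proof. by rewrite -big_split; apply: eq_bigr => i _; rewrite mnmDE mulnDr. Qed.

Lemma form_coord_act (t : 'M[k]_2) (f : {mpoly k[2]}) (i : 'I_n.+1) :
  is_diag_mx t ->
  form_coord (form_act t f) i = t 0 0 ^+ i * t 1 1 ^+ (n - i) * form_coord f i.
Proof.
move=> diag_t; rewrite /form_coord mcoeff_form_act //.
by rewrite !mnmDE !mulmnE !mnm1E /= !mul1n !mul0n addn0 add0n.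
Qed.

Lemma eval_form_act (t : 'M[k]_2) (f : {mpoly k[2]}) (P : {mpoly k[n.+1]}) :
  is_diag_mx t ->
  eval_form P (form_act t f) = \sum_(m <- msupp P)
    P@_m * (t 0 0 ^+ xdeg m * t 1 1 ^+ ydeg m) * \prod_i form_coord f i ^+ m i.
Proof.
move=> diag_t; rewrite /eval_form mevalE; apply: eq_bigr => m _.
rewrite -mulrA; congr (_ * _).
rewrite /xdeg /ydeg -!prodrXr -!big_split /=; apply: eq_bigr => i _.
by rewrite form_coord_act // !exprMn -!exprM.
Qed.

Lemma balanced_invariant (m : 'X_{1..n.+1}) : balanced m ->
  @torus_invariant k n 'X_[m].
Proof.
move=> /eqP bal t f /andP[/eqP det_t diag_t] _; rewrite eval_form_act // /eval_form mevalE.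
rewrite (eq_big_seq (fun m' => ('X_[m])@_m' * \prod_i form_coord f i ^+ m' i)) //.
move=> m'; rewrite msuppX inE => /eqP ->; congr (_ * _).
by rewrite bal -exprMn -det_diag2 // det_t expr1n mulr1.
Qed.

(** The single torus element diag(2, 1/2) detects the weights, because the
    powers of 2 are distinct in characteristic 0. *)
Lemma invariant_balanced (P : {mpoly k[n.+1]}) : torus_invariant P ->
  {in msupp P, forall m, balanced m}.
Proof.
move=> invP m mP.
have two0 : (2 : k) != 0 by rewrite ((pcharf0P k).1 char0).
pose t : 'M[k]_2 := diag_mx (\row_j (if j == 0 then 2 else 2^-1)).
have diag_t : is_diag_mx t by apply: diag_mx_is_diag.
have t00 : t 0 0 = 2 by rewrite !mxE.
have t11 : t 1 1 = 2^-1 by rewrite !mxE.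
have torus_t : in_torus t.
  by rewrite /in_torus diag_t andbT /in_SL2 det_diag2 // t00 t11 divff.
pose Q : {mpoly k[n.+1]} :=
  \sum_(m <- msupp P) (P@_m * (2 ^+ xdeg m * 2^-1 ^+ ydeg m - 1)) *: 'X_[m].
have Q0 : Q = 0.
  apply: (meval_eq0 char0) => c.
  pose f : {mpoly k[2]} :=
    \sum_(i < n.+1) c i *: 'X_[U_(0%R) *+ i + U_(1%R) *+ (n - i)].
  have f_homog : f \is n.-homog.
    apply: rpred_sum => i _; apply: rpredZ; rewrite dhomogX /=.
    by rewrite mdegD !mdegMn !mdeg1 !mul1n subnKC // -ltnS.
  have fE i : form_coord f i = c i.
    rewrite /form_coord (raddf_sum (mcoeff _)) (bigD1 i) //= mcoeffZ mcoeffX eqxx mulr1.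
    rewrite big1 ?addr0 // => j ji; rewrite mcoeffZ mcoeffX; case: eqP; last by rewrite mulr0.
    move/mnmP/(_ 0); rewrite !mnmDE !mulmnE !mnm1E /= !mul1n !mul0n !addn0 => /val_inj E.
    by rewrite E eqxx in ji.
  have := invP t f torus_t f_homog; rewrite eval_form_act // /eval_form mevalE.
  move/eqP; rewrite -subr_eq0 -sumrB => /eqP <-; rewrite /Q raddf_sum /=.
  apply: eq_bigr => m' _; rewrite mevalZ mevalX t00 t11.
  rewrite (eq_bigr (fun i => form_coord f i ^+ m' i)) => [|i _]; last by rewrite fE.
  by rewrite -mulrBl mulrBr mulr1.
have := congr1 (mcoeff m) Q0; rewrite mcoeff0 (raddf_sum (mcoeff m)) /=.
rewrite (bigD1_seq m) //= mcoeffZ mcoeffX eqxx mulr1 big1 => [|m' m'm]; last first.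
  by rewrite mcoeffZ mcoeffX (negbTE m'm) mulr0.
move/eqP; rewrite addr0 mulf_eq0 -[P@_m == 0]negbK -mcoeff_msupp mP /=.
rewrite subr_eq0 exprVn -(inj_eq (mulIf (expf_neq0 (ydeg m) two0))) mul1r divfK ?expf_neq0 //.
by rewrite -!natrX => /eqP/(natr_inj char0)/eqP; rewrite eqn_exp2l.
Qed.

(** The quantifier ranges over a finite type of monomials, which contains all
    the divisors of [m]; this makes the predicate decidable. *)
Definition indecomposable (m : 'X_{1..n.+1}) : bool :=
  [&& m != 0%MM, balanced m &
   [forall m' : 'X_{1..n.+1 < (mdeg m).+1},
      (m' <= m)%MM && balanced m' ==> (bmnm m' == 0%MM) || (bmnm m' == m)]].

Definition weight (i : 'I_n.+1) : int := (i.*2)%:Z - n%:Z.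

Lemma total_weightE (m : 'X_{1..n.+1}) :
  total_weight weight m = (xdeg m)%:Z - (ydeg m)%:Z.
Proof.
rewrite /xdeg /ydeg !(big_morph _ PoszD (erefl 0%:Z)) -sumrB; apply: eq_bigr => i _.
rewrite /weight -mulr_natr natz !PoszM -mulrBl; congr (_ * _).
by have := ltn_ord i; lia.
Qed.

Lemma balancedE m : balanced m = (total_weight weight m == 0).
Proof. by rewrite total_weightE subr_eq0. Qed.

Lemma indecomposable_irreducible m : indecomposable m ->
  irreducible_mult weight m.
Proof.
case/and3P=> _ bal_m /forallP ind; split; first by apply/eqP; rewrite -balancedE.
move=> m' le_m'm w0; pose M := [multinom m' i | i < n.+1].
have leM : (M <= m)%MM by apply/mnm_lepP => i; rewrite mnmE.
have ltM : (mdeg M < (mdeg m).+1)%N.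
  by rewrite ltnS !mdegE; apply: leq_sum => i _; rewrite mnmE.
have := ind (BMultinom ltM); rewrite /= leM /= balancedE.
have -> : total_weight weight M = total_weight weight m'.
  by apply: eq_bigr => i _; rewrite mnmE.
rewrite w0 eqxx /= => /orP[] /eqP/mnmP E; [left|right] => i.
  by rewrite -(mnm0E i) -E mnmE.
by rewrite -E mnmE.
Qed.

Lemma weight_inj : injective weight.
Proof. by move=> i j; rewrite /weight => ij; apply: val_inj => /=; lia. Qed.

Lemma weight_bound i : - n%:Z <= weight i <= n%:Z.
Proof. by rewrite /weight; have := ltn_ord i; lia. Qed.

Lemma indecomposable_degree m : indecomposable m -> (mdeg m < n.*2.+3)%N.
Proof.
move=> /indecomposable_irreducible; rewrite ltnS mdegE.
exact: irreducible_degree weight_inj weight_bound _.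
Qed.

(** Finitely many monomials suffice, by [indecomposable_degree]. *)
Definition indecomposables : seq {mpoly k[n.+1]} :=
  [seq 'X_[bmnm m] | m : 'X_{1..n.+1 < n.*2.+3} in
     [pred m : 'X_{1..n.+1 < n.*2.+3} | indecomposable m]].

Lemma mem_indecomposables m : indecomposable m -> 'X_[m] \in indecomposables.
Proof.
move=> ind; apply/imageP; exists (BMultinom (indecomposable_degree ind)) => //.
Qed.

Lemma indecomposables_uniq : uniq indecomposables.
Proof.
rewrite map_inj_uniq ?enum_uniq // => m m' /(congr1 (mcoeff m)) /eqP.
rewrite !mcoeffX eqxx; case: (bmnm m' =P bmnm m) => [E _|_].
  by apply/eqP; rewrite bmeqP E.
by rewrite oner_eq0.
Qed.

Definition generated (P : {mpoly k[n.+1]}) : Prop :=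
  exists Q : {mpoly k[size indecomposables]}, P = Q \mPo in_tuple indecomposables.

(** By induction on the degree: a decomposable monomial of weight zero is a
    product of two such monomials of smaller degree. *)
Lemma balanced_generated m : balanced m -> generated 'X_[m].
Proof.
have [d] := ubnP (mdeg m); elim: d m => // d IHd m; rewrite ltnS => le_d bal_m.
have [->|m0] := eqVneq m 0%MM.
  by exists 1; rewrite comp_mpoly1 mpolyX0.
case: (boolP (indecomposable m)) => [/mem_indecomposables mS|].
  have lt_S : (index 'X_[m] indecomposables < size indecomposables)%N by rewrite index_mem.
  exists 'X_(Ordinal lt_S); rewrite comp_mpolyXU /=.
  by rewrite nth_index.
rewrite /indecomposable m0 bal_m /= => /forallPn[[m' /= _]].
rewrite negb_imply negb_or => /andP[/andP[le_m' bal_m'] /andP[m'0 m'm]].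
have E : m = (m - m' + m')%MM by rewrite submK.
have deg_m : mdeg m = (mdeg (m - m')%MM + mdeg m')%N by rewrite -mdegD -E.
have sub0 : (m - m')%MM != 0%MM.
  by apply: contraNneq m'm => D; rewrite [X in _ == X]E D add0m.
have bal_sub : balanced (m - m')%MM.
  move: bal_m; rewrite /balanced {1 2}E xdegD ydegD (eqP bal_m').
  by rewrite eqn_add2r.
have [Q QE] : generated 'X_[m'].
  apply: IHd bal_m'; move: sub0; rewrite -mdeg_eq0; lia.
have [Q' Q'E] : generated 'X_[(m - m')%MM].
  apply: IHd bal_sub; move: m'0; rewrite -mdeg_eq0; lia.
by exists (Q' * Q); rewrite E mpolyXD QE Q'E rmorphM.
Qed.

Lemma indecomposables_generate : generates_invariants indecomposables.
Proof.
split=> [P /imageP[m]|P invP].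
  by rewrite inE => /and3P[_ bal_m _] ->; apply: balanced_invariant.
rewrite -/(generated P) [P]mpolyE big_seq.
apply: big_ind => [|p q [Q ->] [Q' ->]|m mP].
- by exists 0; rewrite comp_mpoly0.
- by exists (Q + Q'); rewrite comp_mpolyD.
have [Q ->] := balanced_generated (invariant_balanced invP mP).
by exists (P@_m *: Q); rewrite comp_mpolyZ.
Qed.

End Fixed.

Lemma generators_le (k : fieldType) (n : nat) : [pchar k] =i pred0 ->
  exists S : seq {mpoly k[n.+1]},
    [/\ uniq S, @generates_invariants k n S & (size S <= #|sparse_mults n|)%N].
Proof.
move=> char0; exists (indecomposables k n); split.
- exact: indecomposables_uniq.
- exact: indecomposables_generate.
rewrite size_map -cardE.
pose f (m : 'X_{1..n.+1 < n.*2.+3}) : {ffun 'I_n.+1 -> 'I_(n.*2.+3)} :=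
  [ffun i => inord (bmnm m i)].
have fE m i : f m i = bmnm m i :> nat.
  rewrite ffunE inordK // (leq_ltn_trans _ (bmdeg m)) //.
  by rewrite mdegE (bigD1 i) //= leq_addr.
have f_inj : injective f.
  move=> m m' ff; apply/val_inj/mnmP => i.
  by rewrite -!fE ff.
rewrite -(card_imset _ f_inj); apply/subset_leq_card/subsetP => _ /imsetP[m + ->].
rewrite !inE => /indecomposable_irreducible irr; apply/andP; split.
  have -> : nsupp (f m) = #|[set i | (0 < bmnm m i)%N]|.
    by apply: eq_card => i; rewrite !inE fE.
  exact: irreducible_support (@weight_inj n) (@weight_bound n) _ irr.
rewrite (eq_bigr (fun i => bmnm m i)) => [|i _]; last exact: fE.
exact: irreducible_degree (@weight_inj n) (@weight_bound n) _ irr.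
Qed.


Theorem minimal_generators_le (k : fieldType) (n : nat) : [pchar k] =i pred0 ->
  exists2 m, minimal_generating_card k n m & (m <= #|sparse_mults n|)%N.
Proof.
move=> char0; have [S [uS genS le_S]] := generators_le n char0.
pose P m := `[< exists S : seq {mpoly k[n.+1]},
  [/\ uniq S, generates_invariants S & size S = m] >].
have exP : exists m, P m by exists (size S); apply/asboolP; exists S.
case: (ex_minnP exP) => m /asboolP mP min_m; exists m.
  by split=> // S' uS' genS'; apply: min_m; apply/asboolP; exists S'.
by apply: leq_trans le_S; apply: min_m; apply/asboolP; exists S.
Qed.

End Invariants.

From mathcomp Require Import classical_sets reals topology normedtype landau.
From mathcomp Require Import sequences exp.
From mathcomp Require Import ring lra.

Import numFieldNormedType.Exports.
Local Open Scope classical_set_scope.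

(** * Asymptotic bounds *)

Section Growth.
Variable R : realType.
Local Notation root n := (Num.sqrt (n%:R : R)).

(** This is [exp (- 1/2) >= 1 - 1/2]. *)
Lemma ln2_ge_half : 2^-1 <= ln 2 :> R.
Proof.
have e0 : 0 < expR (2^-1 : R) := expR_gt0 _.
rewrite -ler_expR [leRHS]lnK ?posrE //.
have := expR_ge1Dx (- 2^-1 : R); rewrite expRN -[leRHS]mul1r ler_pdivlMr //; lra.
Qed.

Lemma nsupp_le_root n m : (100 <= n)%N -> m \in sparse_mults n ->
  (nsupp m)%:R <= 6 * root n.
Proof.
move=> n100; rewrite !inE => /andP[t2 _].
have t36 : (nsupp m ^ 2 <= 36 * n)%N.
  move: (nsupp m) t2 => t; rewrite -!mulnn => t2.
  rewrite leqNgt; apply/negP => big_t; have : (n <= t + 11)%N by lia.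
  nia.
have -> : 6 * root n = Num.sqrt ((36 * n)%:R : R).
  rewrite natrM sqrtrM // -[36%:R](_ : 6%:R ^+ 2 = _); last by rewrite -natrX.
  by rewrite sqrtr_sqr ger0_norm.
by rewrite -[leLHS]ger0_norm // -sqrtr_sqr ler_sqrt // -natrX ler_nat.
Qed.

(** A sum of weights that are all at least [expR (- A)] bounds the number of
    terms. *)
Lemma card_sparse_mults n : (100 <= n)%N ->
  (#|sparse_mults n|%:R : R) <= expR (6 * root n * ln n%:R + 3 * root n + 9).
Proof.
move=> n100; set q := root n.
have n0 : 0 < n%:R :> R by rewrite ltr0n; lia.
have q0 : 0 < q by rewrite sqrtr_gt0.
have qq : q * q = n%:R by rewrite -expr2 sqr_sqrtr // ltW.
have q1 : 1 <= q by rewrite -sqrtr1 ler_sqrt ?ler1n //; lia.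
have n1 : 0 < n.+1%:R :> R by rewrite ltr0n.
(* With z = exp (- 1 / q) the geometric factor 1 / (1 - z) is of order q, and
   y = 1 / (n + 1) makes the product of the n + 1 factors at most exp (1 + q). *)
pose y := expR (- ln (n.+1%:R : R)); pose z := expR (- q^-1).
have y0 : 0 < y := expR_gt0 _.
have yE : y = (n.+1%:R)^-1 by rewrite /y expRN lnK ?posrE.
have z1 : 0 < z < 1.
  by rewrite expR_gt0 -[ltRHS]expR0 ltr_expR oppr_lt0 invr_gt0.
have z_gap : (1 - z)^-1 <= 1 + q.
  have z_le : z <= q / (1 + q).
    rewrite /z expRN -[leRHS]invrK lef_pV2 ?posrE ?expR_gt0 ?invr_gt0 ?divr_gt0 ?addr_gt0 //.
    rewrite invf_div mulrDl divff ?gt_eqF // div1r addrC.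
    exact: expR_ge1Dx.
  have sz : 0 < 1 - z by rewrite subr_gt0; case/andP: z1.
  rewrite -[leRHS]invrK lef_pV2 ?posrE ?invr_gt0 ?sz ?addr_gt0 //.
  have -> : (1 + q)^-1 = 1 - q / (1 + q).
    by field; rewrite gt_eqF // addr_gt0.
  by rewrite lerD2l lerN2.
pose A := 6 * q * ln n.+1%:R + (n.*2.+2)%:R / q.
have weight_ge m : m \in sparse_mults n ->
    expR (- A) <= y ^+ nsupp m * z ^+ (\sum_i m i)%N.
  move=> m_sp; rewrite /y /z -!expRM_natl -expRD ler_expR !mulrN -opprD lerN2.
  apply: lerD; first by rewrite ler_wpM2r ?ln_ge0 ?ler1n // nsupp_le_root.
  rewrite ler_pM2r ?invr_gt0 // ler_nat.
  by move: m_sp; rewrite !inE => /andP[].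
have total : #|sparse_mults n|%:R * expR (- A) <= expR (1 + q).
  rewrite mulr_natl -sumr_const.
  apply: (@le_trans _ _ (\sum_(m : {ffun 'I_n.+1 -> 'I_(n.*2.+3)})
            y ^+ nsupp m * z ^+ (\sum_i m i)%N)).
    rewrite big_mkcond /=; apply: ler_sum => m _; case: ifP => [/weight_ge //|_].
    by rewrite mulr_ge0 ?exprn_ge0 ?expR_ge0.
  apply: le_trans (sum_weight_mults _ _ y0 z1) _.
  rewrite -[X in expR X](@divfK _ n.+1%:R) ?gt_eqF // expRM_natr.
  apply: lerXn2r; rewrite ?nnegrE ?expR_ge0 //.
    by rewrite addr_ge0 // divr_ge0 ?(ltW y0) // subr_ge0 ltW //; case/andP: z1.
  apply: le_trans (expR_ge1Dx _); rewrite lerD2l yE [leLHS]mulrC.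
  by rewrite ler_pM2r ?invr_gt0.
have -> : #|sparse_mults n|%:R = #|sparse_mults n|%:R * expR (- A) * expR A.
  by rewrite -mulrA -expRD addNr expR0 mulr1.
apply: (@le_trans _ _ (expR (1 + q) * expR A)); first by rewrite ler_pM2r ?expR_gt0.
rewrite -expRD ler_expR /A.
have qV : q^-1 <= 1 by rewrite invf_le1.
have ln_le : 6 * q * ln n.+1%:R <= 6 * q * ln n%:R + 6.
  have -> : ln n.+1%:R = ln n%:R + ln (1 + n%:R^-1) :> R.
    rewrite -lnM ?posrE ?addr_gt0 ?invr_gt0 // mulrDr mulr1 divff ?gt_eqF //.
    by rewrite natr1.
  rewrite mulrDr lerD2l -mulrA -[leRHS]mulr1 ler_pM2l //.
  apply: (@le_trans _ _ (q * n%:R^-1)).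
    by rewrite ler_pM2l // le_ln1Dx // (@lt_trans _ _ 0) // ?invr_gt0 //; lra.
  by rewrite -qq invfM mulrA divff ?gt_eqF // mul1r.
have div_q : (n.*2.+2)%:R / q <= 2 * q + 2.
  have -> : (n.*2.+2)%:R = 2 * (q * q) + 2 :> R.
    by rewrite qq -addn2 natrD -muln2 natrM mulrC.
  rewrite mulrDl mulrA mulfK ?gt_eqF // lerD2l -[leRHS]mulr1.
  by rewrite ler_pM2l.
lra.
Qed.

Lemma odd_exponent_ge n : (100 <= n)%N ->
  6 * root n * ln n%:R + 3 * root n <= 6 * root n * ln (2 * n%:R).
Proof.
move=> n100; have n0 : 0 < n%:R :> R by rewrite ltr0n; lia.
have q0 : 0 <= root n := sqrtr_ge0 _.
rewrite lnM ?posrE // mulrDr addrC lerD2r.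
by have := ler_wpM2l q0 ln2_ge_half; lra.
Qed.

Lemma even_exponent_ge n : (100 <= n)%N ->
  6 * root n * ln n%:R + 3 * root n <= 12 * Num.sqrt (n%:R / 2) * ln n%:R.
Proof.
move=> n100; have n0 : 0 < n%:R :> R by rewrite ltr0n; lia.
have q0 : 0 <= root n := sqrtr_ge0 _.
have ln_n : 3 / 2 <= ln (n%:R : R).
  apply: (@le_trans _ _ (ln ((2 : R) ^+ 3))).
    by rewrite lnXn // -mulr_natl; have := ln2_ge_half; lra.
  by rewrite ler_ln ?posrE ?exprn_gt0 // -natrX ler_nat; lia.
have root2 : 2 / 3 * root n <= Num.sqrt (n%:R / 2).
  rewrite -[leLHS]ger0_norm; last by rewrite mulr_ge0 // divr_ge0.
  rewrite -sqrtr_sqr ler_sqrt; last by rewrite divr_ge0 // ltW.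
  rewrite exprMn sqr_sqrtr ?ltW //; lra.
apply: (@le_trans _ _ (8 * root n * ln n%:R)).
  by have := ler_wpM2l q0 ln_n; lra.
rewrite ler_wpM2r //; first by lra.
by move: root2; lra.
Qed.

End Growth.

Theorem theorem2 (R : realType) (k : closedFieldType)
    (char0 : [pchar k] =i pred0) :
  exists mu : nat -> nat,
    [/\ forall n : nat, (1 <= n)%N -> minimal_generating_card k n (mu n),
        (fun n : nat => (mu n)%:R : R)
          =O_ (within [set n : nat | odd n] \oo)
        (fun n : nat =>
           n%:R * expR (6 * Num.sqrt n%:R * ln (2 * n%:R)) : R) &
        (fun n : nat => (mu n)%:R : R)
          =O_ (within [set n : nat | ~~ odd n] \oo)
        (fun n : nat =>
           n%:R * expR (12 * Num.sqrt (n%:R / 2) * ln n%:R) : R)].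
Proof.
have ex_mu n : exists m, minimal_generating_card k n m /\ (m <= #|sparse_mults n|)%N.
  by have [m mP le_m] := Invariants.minimal_generators_le n char0; exists m.
have [mu muP] := choice ex_mu.
have bound n (x : R) : (100 <= n)%N ->
    6 * Num.sqrt n%:R * ln n%:R + 3 * Num.sqrt n%:R <= x ->
    `|(mu n)%:R : R| <= expR 9 * `|n%:R * expR x|.
  move=> n100 le_x; rewrite !ger0_norm ?mulr_ge0 ?expR_ge0 //.
  apply: (@le_trans _ _ #|sparse_mults n|%:R); first by rewrite ler_nat; have [] := muP n.
  apply: le_trans (card_sparse_mults R n100) _.
  apply: (@le_trans _ _ (expR 9 * expR x)); first by rewrite -expRD ler_expR; lra.
  rewrite ler_pM2l ?expR_gt0 // ler_peMl ?expR_ge0 // ler1n; lia.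
exists mu; split=> [n _||]; first by have [] := muP n.
- apply/eqO_exP; exists (expR 9); first exact: expR_gt0.
  near=> n; apply: bound; last apply: odd_exponent_ge; near: n;
    by apply: cvg_within; exists 100%N.
- apply/eqO_exP; exists (expR 9); first exact: expR_gt0.
  near=> n; apply: bound; last apply: even_exponent_ge; near: n;
    by apply: cvg_within; exists 100%N.
Unshelve. all: by end_near. Qed.
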